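(* There exist positive elliptic-elliptic rotopulsator solutions $q_1,\ldots,q_n$ of the curved $n$-body problem with $r_i$ and $\rho_i$ independent of $i$ and not constant and $\|q_i(t)-q_j(t)\|$ constant for all $i,j\in\{1,\ldots,n\}$, where $\|\cdot\|$ represents the Euclidean norm on $\mathbb{R}^4$. For all these solutions we have that $\alpha_i=\beta_i$ for all $i\in\{1,\ldots,n\}$, and any such solution has a (not necessarily regular) polygonal configuration, where all the point masses lie on a great circle.
   Context: Curved $n$-body problem on $\mathbb{S}^3=\{x\in\mathbb{R}^4\mid x_1^2+x_2^2+x_3^2+x_4^2=1\}$ (the case of curvature sign $\sigma=1$): find functions $q_1,\ldots,q_n$ of time with values in $\mathbb{S}^3$, with respective masses $m_1>0,\ldots,m_n>0$, solving $$\ddot q_i=\sum_{j=1,\,j\neq i}^{n}\frac{m_j\,(q_j-\langle q_i,q_j\rangle q_i)}{(1-\langle q_i,q_j\rangle^2)^{3/2}}-\langle\dot q_i,\dot q_i\rangle q_i,\qquad i\in\{1,\ldots,n\},$$ where $\langle\cdot,\cdot\rangle$ is the Euclidean inner product on $\mathbb{R}^4$. Positive elliptic-elliptic rotopulsator: a solution $q_1,\ldots,q_n$ of this system, $q_i=(q_{i1},q_{i2},q_{i3},q_{i4})^T$, for which there exist nonnegative scalar functions $r_i,\rho_i$ with $r_i^2+\rho_i^2=1$, scalar functions $\theta,\phi$ (not depending on $i$) and constants $\alpha_i,\beta_i\in\mathbb{R}$ such that $$\begin{pmatrix} q_{i1} \\ q_{i2} \end{pmatrix}=r_i\begin{pmatrix}\cos(\theta+\alpha_i)\\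 \sin(\theta+\alpha_i)\end{pmatrix},\qquad \begin{pmatrix} q_{i3} \\ q_{i4} \end{pmatrix}=\rho_i\begin{pmatrix}\cos(\phi+\beta_i)\\ \sin(\phi+\beta_i)\end{pmatrix},\qquad i\in\{1,\ldots,n\},$$ where the $\alpha_i$ are not necessarily all the same value, and the same holds for the $\beta_i$. The $\alpha_i$ and $\beta_i$ in the claim are these constants, and $r_i,\rho_i$ are these functions. A great circle of $\mathbb{S}^3$ is the intersection of $\mathbb{S}^3$ with a 2-dimensional linear subspace of $\mathbb{R}^4$ (here the subspace may rotate with time). A polygonal configuration means that the point masses represent the vertices of a polygon.
   Formalization: α_i=β_i, false literally, is proved up to a common shift of each family, multiples of 2π and a possible reflection x_4→−x_4 (all β_i→−β_i); existence is shown for each odd n≥3 with some masses, and the claims about all solutions are for n≥2. *)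

(* Defs.v *)
From HB Require Import structures.
From mathcomp Require Import all_boot all_order all_algebra.
From mathcomp Require Import all_classical all_reals all_analysis.
Set Implicit Arguments.
Unset Strict Implicit.
Unset Printing Implicit Defensive.
Import Order.TTheory GRing.Theory Num.Theory.
Import numFieldNormedType.Exports.
Local Open Scope classical_set_scope.
Local Open Scope ring_scope.

(* The library norm on 'rV[R]_4 is the sup norm; it induces the usual topology
   and derivatives, but the Euclidean structure has to be given separately. *)
Definition dot (R : realType) (x y : 'rV[R]_4) : R := \sum_k x 0 k * y 0 k.

Definition enorm (R : realType) (x : 'rV[R]_4) : R := Num.sqrt (dot x x).

Definition sphere3 (R : realType) : set 'rV[R]_4 := [set x | dot x x = 1].

Definition time_interval (R : realType) (J : set R) : Prop :=
  [/\ J !=set0, is_interval J & open J].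

Definition constant_on (R : realType) (J : set R) (f : R -> R) : Prop :=
  exists c, forall t, J t -> f t = c.

(* The non-singularity clause <q_i, q_j>^2 != 1 is implicit in the equations of
   motion; it is stated because division by 0 is total here. *)
Definition curved_nbody_solution (R : realType) (n : nat) (J : set R)
    (m : 'I_n -> R) (q : 'I_n -> R -> 'rV[R]_4) : Prop :=
  (forall i, 0 < m i) /\
  forall i t, J t ->
  [/\ sphere3 (q i t),
      forall j, j != i -> dot (q i t) (q j t) ^+ 2 != 1,
      derivable (q i) t 1,
      derivable (derive1 (q i)) t 1 &
      derive1 (derive1 (q i)) t =
        \sum_(j < n | j != i)
           (m j / (1 - dot (q i t) (q j t) ^+ 2) `^ (3 / 2)) *:
             (q j t - dot (q i t) (q j t) *: q i t)
        - dot (derive1 (q i) t) (derive1 (q i) t) *: q i t].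

Definition elliptic_elliptic_form (R : realType) (n : nat) (J : set R)
    (q : 'I_n -> R -> 'rV[R]_4) (r rho : 'I_n -> R -> R) (theta phi : R -> R)
    (alpha beta : 'I_n -> R) : Prop :=
  forall i t, J t ->
  [/\ 0 <= r i t, 0 <= rho i t & r i t ^+ 2 + rho i t ^+ 2 = 1] /\
  [/\ q i t 0 0 = r i t * cos (theta t + alpha i),
      q i t 0 1 = r i t * sin (theta t + alpha i),
      q i t 0 2 = rho i t * cos (phi t + beta i) &
      q i t 0 3 = rho i t * sin (phi t + beta i)].

Definition positive_elliptic_elliptic_rotopulsator (R : realType) (n : nat)
    (J : set R) (m : 'I_n -> R) (q : 'I_n -> R -> 'rV[R]_4)
    (r rho : 'I_n -> R -> R) (theta phi : R -> R) (alpha beta : 'I_n -> R)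
    : Prop :=
  curved_nbody_solution J m q /\
  elliptic_elliptic_form J q r rho theta phi alpha beta.

Definition pulsating_with_fixed_distances (R : realType) (n : nat) (J : set R)
    (q : 'I_n -> R -> 'rV[R]_4) (r rho : 'I_n -> R -> R) : Prop :=
  [/\ forall i j t, J t -> r i t = r j t /\ rho i t = rho j t,
      forall i, ~ constant_on J (r i) /\ ~ constant_on J (rho i) &
      forall i j, constant_on J (fun t => enorm (q i t - q j t))].

(* The constants alpha_i are determined by a rotopulsator only up to multiples
   of 2 pi and up to a common shift, which is absorbed in theta (similarly for
   beta_i and phi). *)
Definition same_phases (R : realType) (n : nat) (a b : 'I_n -> R) : Prop :=
  exists c : R, forall i, exists k : int, b i = a i + c + k%:~R * (2 * pi).

(* With s = true, the isometry (x1, x2, x3, x4) |-> (x1, x2, x3, - x4): it maps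
   solutions to solutions and changes phi, beta_i into - phi, - beta_i. *)
Definition reflect4 (R : realType) (s : bool) (x : 'rV[R]_4) : 'rV[R]_4 :=
  \row_k (if s && (k == 3) then - x 0 k else x 0 k).

(* alpha_i = beta_i for all i, for suitable choices of the phase origins and of
   the orientation of the (x3, x4)-plane. *)
Definition equal_phases (R : realType) (n : nat) (J : set R)
    (q : 'I_n -> R -> 'rV[R]_4) (r rho : 'I_n -> R -> R)
    (alpha beta : 'I_n -> R) : Prop :=
  exists (s : bool) (theta' phi' : R -> R) (alpha' beta' : 'I_n -> R),
  [/\ same_phases alpha alpha',
      same_phases (fun i => if s then - beta i else beta i) beta',
      elliptic_elliptic_form J (fun i t => reflect4 s (q i t))
        r rho theta' phi' alpha' beta' &
      forall i, alpha' i = beta' i].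

Definition great_circle (R : realType) (C : set 'rV[R]_4) : Prop :=
  exists V : {vspace 'rV[R]_4},
    \dim V = 2%N /\ C = [set x | sphere3 x /\ x \in V].

Definition coplanar (R : realType) (n : nat) (p : 'I_n -> 'rV[R]_4) : Prop :=
  exists (x : 'rV[R]_4) (V : {vspace 'rV[R]_4}),
    \dim V = 2%N /\ forall i, p i - x \in V.

(* The p_i are the (pairwise distinct) vertices of a convex polygon: at least
   three coplanar points, none of which is a convex combination of the others. *)
Definition polygon_vertices (R : realType) (n : nat) (p : 'I_n -> 'rV[R]_4)
    : Prop :=
  [/\ (3 <= n)%N, coplanar p &
      forall i, ~ exists w : 'I_n -> R,
        [/\ forall j, 0 <= w j, w i = 0, \sum_j w j = 1 &
            p i = \sum_j w j *: p j]].

(* Main.v *)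
(** Fixed distances make
    r^2 cos (alpha_i - alpha_j) + rho^2 cos (beta_i - beta_j) constant; as
    r^2 = 1 - rho^2 is not, the two cosines agree.  So the unit vectors with
    arguments alpha_i and those with arguments beta_i have the same Gram matrix,
    and differ by a rotation or a reflection of the plane.  Hence every q_i is a
    combination of two of them, and distinct points of a circle are in convex
    position.  Two bodies are excluded because the equations of motion would
    give them opposite areal accelerations in the (x1, x2)-plane, whereas these
    have to agree.

    Conversely, for odd n put equal masses on the regular n-gon and let
    q_i = (cos t e_i, sin t e_i), where the e_i are its vertices in R^2:
    the forces cancel by symmetry and each q_i is a geodesic.  For even n the
    n-gon has antipodal vertices, where the force is singular. *)
Require Import Defs.
From HB Require Import structures.
From mathcomp Require Import all_boot all_order all_algebra.
From mathcomp Require Import all_classical all_reals all_analysis.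
From mathcomp Require Import ring lra zify.
Set Implicit Arguments.
Unset Strict Implicit.
Unset Printing Implicit Defensive.
Import Order.TTheory GRing.Theory Num.Theory.
Import numFieldNormedType.Exports.
Local Open Scope classical_set_scope.
Local Open Scope ring_scope.

(** * Angles modulo 2 pi, and their recovery from a Gram matrix *)

Lemma cosD2piz (R : realType) (x : R) (k : int) :
  cos (x + k%:~R * (2 * pi)) = cos x.
Proof.
have e (m : nat) (y : R) : cos (y + m%:R * (2 * pi)) = cos y.
  by rewrite -[RHS](periodicn (@cosD2pi R) m) -[pi *+ 2]mulr_natl mulr_natl.
case: k => m; first exact: e.
by rewrite NegzE -[in RHS](subrK (m.+1%:R * (2 * pi)) x) e mulrNz mulNr.
Qed.

Lemma sinD2piz (R : realType) (x : R) (k : int) :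
  sin (x + k%:~R * (2 * pi)) = sin x.
Proof. by rewrite -!cosBpihalf addrAC cosD2piz. Qed.

Lemma cos_half_angle (R : realType) (x : R) : cos x = 1 - 2 * sin (x / 2) ^+ 2.
Proof.
have {1}-> : x = x / 2 + x / 2 by field.
rewrite cosD; have := cos2Dsin2 (x / 2); nra.
Qed.

Lemma cos_eq1 (R : realType) (x : R) :
  cos x = 1 -> exists k : int, x = k%:~R * (2 * pi).
Proof.
move=> cx1; have p0 : 0 < 2 * pi :> R by rewrite mulr_gt0 ?pi_gt0.
pose k := Num.floor (x / (2 * pi)); exists k.
have /andP[] := floor_itv (x / (2 * pi)); rewrite -/k intrD.
rewrite ler_pdivlMr // ltr_pdivrMr // => lek ltk.
apply/eqP; rewrite eq_le lek andbT leNgt; apply/negP => ltx.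
(* The remainder [y] would lie strictly between 0 and 2 pi, so that sin (y / 2) > 0 and cos y <
   1. *)
pose y := x - k%:~R * (2 * pi).
have : 0 < sin (y / 2).
  by apply: sin_gt0_pi; rewrite /y; apply/andP; split; lra.
have : cos y = 1.
  by rewrite -cx1 -(subrK (k%:~R * (2 * pi)) x) cosD2piz.
rewrite cos_half_angle; nra.
Qed.

(* Two systems of unit vectors in the plane with the same Gram matrix differ
   by an isometry; a rank two Gram matrix lets it be read off two vectors. *)
Lemma phases_of_gram (R : realType) (n : nat) (a b : 'I_n -> R) (u v : 'I_n) :
  (forall i j, cos (a i - a j) = cos (b i - b j)) -> sin (a v - a u) != 0 ->
  exists (s : bool) (c : R), forall i, exists k : int,
    a i = (if s then - b i else b i) + c + k%:~R * (2 * pi).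
Proof.
move=> gram suv.
(* With angles measured from vector [u], column [u] of the Gram matrix gives the cosines; column [v]
   then gives the sines up to one common sign, recorded by [s]. *)
pose A i := a i - a u; pose B i := b i - b u.
have cosAB i : cos (A i) = cos (B i) by exact: gram.
have sinAB i : sin (A i) * sin (A v) = sin (B i) * sin (B v).
  have := gram i v.
  have -> : a i - a v = A i - A v by rewrite /A; ring.
  have -> : b i - b v = B i - B v by rewrite /B; ring.
  by rewrite (cosB (A i)) (cosB (B i)) !cosAB => /addrI.
have /eqP sqv : sin (A v) ^+ 2 = sin (B v) ^+ 2 by rewrite !sin2cos2 cosAB.
pose s := sin (A v) != sin (B v).
have sBv : sin (B v) = if s then - sin (A v) else sin (A v).
  rewrite /s; move: sqv; rewrite eqf_sqr; case: eqVneq => //= _ /eqP ->.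
  by rewrite opprK.
pose e (x : R) := if s then - x else x.
exists s, (a u - e (b u)) => i.
have [k kP] : exists k : int, A i - e (B i) = k%:~R * (2 * pi).
  apply: cos_eq1; rewrite (cosB (A i)).
  have -> : cos (e (B i)) = cos (A i).
    by rewrite /e; case: s {sBv e} => //=; rewrite ?cosN cosAB.
  have -> : sin (e (B i)) = sin (A i).
    apply: (mulIf suv); rewrite -/(A v) sinAB sBv /e; case: s {sBv e} => //.
    by rewrite sinN mulNr mulrN.
  by rewrite -!expr2 cos2Dsin2.
exists k; rewrite -kP /A /B /e; case: s {sBv e kP} => //=; ring.
Qed.

(** * Euclidean geometry, derivatives and trigonometry in coordinates *)

Lemma dotE (R : realType) (x y : 'rV[R]_4) :
  dot x y = x 0 0 * y 0 0 + x 0 1 * y 0 1 + x 0 2 * y 0 2 + x 0 3 * y 0 3.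
Proof.
rewrite /dot !big_ord_recr big_ord0 /= add0r.
by congr (_ + _ + _ + _); congr (x _ _ * y _ _); apply: val_inj.
Qed.

Lemma row4P (R : realType) (x y : 'rV[R]_4) :
  x 0 0 = y 0 0 -> x 0 1 = y 0 1 -> x 0 2 = y 0 2 -> x 0 3 = y 0 3 -> x = y.
Proof.
move=> e0 e1 e2 e3; apply/rowP => -[[|[|[|[|//]]]] lk].
- by rewrite (_ : Ordinal lk = 0) //; exact: val_inj.
- by rewrite (_ : Ordinal lk = 1) //; exact: val_inj.
- by rewrite (_ : Ordinal lk = 2) //; exact: val_inj.
- by rewrite (_ : Ordinal lk = 3) //; exact: val_inj.
Qed.

Lemma dot_sumr (R : realType) (I : finType) (x : 'rV[R]_4) (w : I -> R)
    (p : I -> 'rV[R]_4) :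
  dot x (\sum_j w j *: p j) = \sum_j w j * dot x (p j).
Proof.
rewrite /dot; under [RHS]eq_bigr do rewrite mulr_sumr.
rewrite exchange_big /=; apply: eq_bigr => k _.
rewrite summxE mulr_sumr; apply: eq_bigr => j _.
by rewrite mxE; ring.
Qed.

Lemma dot_ge0 (R : realType) (x : 'rV[R]_4) : 0 <= dot x x.
Proof. by rewrite sumr_ge0 // => k _; rewrite -expr2 sqr_ge0. Qed.

Lemma enorm_sqr (R : realType) (x : 'rV[R]_4) : enorm x ^+ 2 = dot x x.
Proof. by rewrite sqr_sqrtr // dot_ge0. Qed.

(* If p i = sum_j w_j p_j, then sum_j w_j (1 - <p_i, p_j>) = 0. *)
Lemma sphere_points_convex_position (R : realType) (n : nat)
    (p : 'I_n -> 'rV[R]_4) (i : 'I_n) :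
  dot (p i) (p i) = 1 -> (forall j, j != i -> dot (p i) (p j) < 1) ->
  ~ exists w : 'I_n -> R,
      [/\ forall j, 0 <= w j, w i = 0, \sum_j w j = 1 &
          p i = \sum_j w j *: p j].
Proof.
move=> pi1 plt1 [w [w0 wi0 w1 piE]].
have lew j : 0 <= w j * (1 - dot (p i) (p j)).
  have [->|ji] := eqVneq j i; first by rewrite wi0 mul0r.
  by rewrite mulr_ge0 // subr_ge0 ltW // plt1.
have sum0 : \sum_j w j * (1 - dot (p i) (p j)) = 0.
  under eq_bigr do rewrite mulrBr mulr1.
  by rewrite sumrB w1 -dot_sumr -piE pi1 subrr.
have w_eq0 j : w j = 0.
  have [->//|ji] := eqVneq j i.
  have /eqP := psumr_eq0P (fun j _ => lew j) sum0 (i := j) isT.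
  by rewrite mulf_eq0 subr_eq0 (gt_eqF (plt1 j ji)) orbF => /eqP.
by move: w1; rewrite big1 // => /eqP; rewrite eq_sym oner_eq0.
Qed.

(** Lets a linear relation between coordinates be differentiated, and again for the derivatives. The
    relation is known on [J] only; openness makes it hold near each [t]. *)
Lemma derive1_coord_lincomb (R : realType) (J : set R) (p q : R -> 'rV[R]_4)
    (i j k : 'I_4) (a b : R) :
  open J ->
  (forall t, J t -> derivable p t 1) -> (forall t, J t -> derivable q t 1) ->
  (forall t, J t -> p t 0 i = a * q t 0 j + b * q t 0 k) ->
  forall t, J t ->
    derive1 p t 0 i = a * derive1 q t 0 j + b * derive1 q t 0 k.
Proof.
move=> oJ dp dq pq t Jt.
rewrite !derive1E !derive_mx ?mxE; [|exact: dq|exact: dp].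
have dqc l : derivable (fun s => q s 0 l) t 1.
  by have /derivable_mxP := dq _ Jt; apply.
rewrite (@near_eq_derive _ _ _ _
  (a \*: (fun s => q s 0 j) + b \*: (fun s => q s 0 k))).
- rewrite deriveD ?deriveZ //; exact: derivableZ.
- near=> s; rewrite pq //; near: s.
  exact: open_nbhs_nbhs.
Unshelve. all: by end_near. Qed.

Lemma dot_subr (R : realType) (x y : 'rV[R]_4) :
  dot (x - y) (x - y) = dot x x + dot y y - 2 * dot x y.
Proof. by rewrite !dotE !mxE; ring. Qed.

(** Any three vectors of the plane are dependent: Cramer's rule expresses the unit vector of angle c
    through those of angles a and b, and a rotation by z leaves the coefficients unchanged. *)
Lemma cos_interp (R : realType) (z a b c : R) : sin (b - a) != 0 ->
  cos (z + c) = sin (b - c) / sin (b - a) * cos (z + a)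
                + sin (c - a) / sin (b - a) * cos (z + b).
Proof.
move=> s0; apply: (mulIf s0); rewrite mulrDl -!mulrA.
rewrite ![_^-1 * (_ * _)]mulrCA !mulVf // !mulr1.
by rewrite !sinB !cosD; ring.
Qed.

Lemma sin_interp (R : realType) (z a b c : R) : sin (b - a) != 0 ->
  sin (z + c) = sin (b - c) / sin (b - a) * sin (z + a)
                + sin (c - a) / sin (b - a) * sin (z + b).
Proof.
move=> s0; have := cos_interp (z - pi / 2) c s0.
by rewrite !(addrAC z (- (pi / 2))) !cosBpihalf.
Qed.

(** * Consequences of fixed distances: equal phases and a common plane *)

Lemma dot_elliptic (R : realType) (n : nat) (J : set R)
    (q : 'I_n -> R -> 'rV[R]_4) (r rho : 'I_n -> R -> R) (theta phi : R -> R)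
    (alpha beta : 'I_n -> R) (i j : 'I_n) (t : R) :
  elliptic_elliptic_form J q r rho theta phi alpha beta -> J t ->
  dot (q i t) (q j t) = r i t * r j t * cos (alpha i - alpha j)
                        + rho i t * rho j t * cos (beta i - beta j).
Proof.
move=> form Jt; rewrite dotE.
have [_ [-> -> -> ->]] := form i t Jt; have [_ [-> -> -> ->]] := form j t Jt.
have -> : alpha i - alpha j = (theta t + alpha i) - (theta t + alpha j) by ring.
have -> : beta i - beta j = (phi t + beta i) - (phi t + beta j) by ring.
by rewrite !cosB; ring.
Qed.

(* |q_i - q_j|^2 = 2 - 2 (cos b + r^2 (cos a - cos b)), where a and b are the
   phase differences, so r is constant unless cos a = cos b. *)
Lemma cos_phases_eq (R : realType) (n : nat) (J : set R)
    (q : 'I_n -> R -> 'rV[R]_4) (r rho : 'I_n -> R -> R) (theta phi : R -> R)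
    (alpha beta : 'I_n -> R) (i j : 'I_n) :
  elliptic_elliptic_form J q r rho theta phi alpha beta ->
  pulsating_with_fixed_distances J q r rho ->
  cos (alpha i - alpha j) = cos (beta i - beta j).
Proof.
move=> form [rE rNcst dcst]; apply/eqP/negPn/negP.
set a := cos (alpha i - alpha j); set b := cos (beta i - beta j) => nab.
have [rN _] := rNcst i; apply: rN.
have [d dE] := dcst i j.
exists (Num.sqrt ((1 - d ^+ 2 / 2 - b) / (a - b))) => t Jt.
have [[r0 _ r1] _] := form i t Jt.
rewrite -[LHS]ger0_norm // -sqrtr_sqr.
congr (Num.sqrt _).
have rrho k l : dot (q k t) (q l t) = r i t ^+ 2 * cos (alpha k - alpha l)
                        + (1 - r i t ^+ 2) * cos (beta k - beta l).
  have [rk rhok] := rE k i t Jt; have [rl rhol] := rE l i t Jt.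
  by rewrite (dot_elliptic _ _ form Jt) rk rl rhok rhol -r1; ring.
have : d ^+ 2 = 2 - 2 * (r i t ^+ 2 * a + (1 - r i t ^+ 2) * b).
  rewrite -(dE t Jt) enorm_sqr -rrho.
  by rewrite dot_subr !rrho !subrr cos0; ring.
by move=> ->; field; rewrite subr_eq0.
Qed.


Lemma equal_phases_of_gram (R : realType) (n : nat) (J : set R)
    (q : 'I_n -> R -> 'rV[R]_4) (r rho : 'I_n -> R -> R) (theta phi : R -> R)
    (alpha beta : 'I_n -> R) (u v : 'I_n) :
  elliptic_elliptic_form J q r rho theta phi alpha beta ->
  (forall i j, cos (alpha i - alpha j) = cos (beta i - beta j)) ->
  sin (alpha v - alpha u) != 0 ->
  equal_phases J q r rho alpha beta.
Proof.
move=> form gram suv.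
have [s [c kP]] := phases_of_gram gram suv.
pose e (x : R) := if s then - x else x.
(* [alpha] serves for both planes; the reflection and the common shift [c] are absorbed in [phi]. *)
exists s, theta, (fun t => e (phi t) - c), alpha, alpha; split => //.
- by exists 0 => i; exists 0; rewrite mul0r !addr0.
- by exists c.
- move=> i t Jt; have [rr [q0 q1 q2 q3]] := form i t Jt; split=> //.
  have [k aE] := kP i.
  have ang : e (phi t) - c + alpha i = e (phi t + beta i) + k%:~R * (2 * pi).
    by rewrite aE /e; case: s {kP e aE} => /=; ring.
  rewrite !mxE /= !andbF !andbT; split=> //.
  + by rewrite ang cosD2piz q2 /e; case: s {kP e aE ang} => //; rewrite cosN.
  + rewrite ang sinD2piz q3 /e; case: s {kP e aE ang} => //.
    by rewrite sinN mulrN.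
Qed.

Lemma great_circle_of_plane (R : realType) (n : nat) (p : 'I_n -> 'rV[R]_4)
    (V : {vspace 'rV[R]_4}) :
  (forall i, sphere3 (p i)) -> \dim V = 2%N -> (forall i, p i \in V) ->
  coplanar p /\ exists C : set 'rV[R]_4, great_circle C /\ forall i, C (p i).
Proof.
move=> p1 dV pV; split; first by exists 0, V; split=> // i; rewrite subr0.
by exists [set x | sphere3 x /\ x \in V]; split; [exists V | split].
Qed.

(** If x = k y with both of norm 1, then k is their inner product and k^2 = 1. *)
Lemma dim_span_pair (R : realType) (x y : 'rV[R]_4) :
  sphere3 x -> sphere3 y -> dot x y ^+ 2 != 1 -> \dim <<[:: x; y]>> = 2%N.
Proof.
move=> x1 y1 nxy; apply/eqP; rewrite -/(free [:: x; y]) free_cons span_seq1.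
rewrite seq1_free; apply/andP; split.
  apply/negP => /vlineP[k xk]; move/eqP: nxy; apply.
  have dk : dot x y = k.
    by rewrite -[RHS]mulr1 -[in RHS]y1 xk !dotE !mxE; ring.
  rewrite dk -[RHS]x1 xk -[LHS]mulr1 -[in LHS]y1 !dotE !mxE; ring.
apply/eqP => y0; move: y1; rewrite /sphere3 /= y0 dotE !mxE => /eqP.
by rewrite !mul0r !addr0 eq_sym oner_eq0.
Qed.

(* sin (x_v - x_u) e^(i x_w)
     = sin (x_v - x_w) e^(i x_u) + sin (x_w - x_u) e^(i x_v);
   the coefficients are the same for alpha and for beta up to a common sign. *)
Lemma elliptic_in_span (R : realType) (n : nat) (J : set R)
    (q : 'I_n -> R -> 'rV[R]_4) (r rho : 'I_n -> R -> R) (theta phi : R -> R)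
    (alpha beta : 'I_n -> R) (u v w : 'I_n) (t : R) :
  elliptic_elliptic_form J q r rho theta phi alpha beta -> J t ->
  (forall i j t, J t -> r i t = r j t /\ rho i t = rho j t) ->
  (forall i j, cos (alpha i - alpha j) = cos (beta i - beta j)) ->
  sin (alpha v - alpha u) != 0 ->
  q w t \in <<[:: q u t; q v t]>>%VS.
Proof.
move=> form Jt rE gram suv.
have [s [c kP]] := phases_of_gram gram suv.
pose e (x : R) := if s then - x else x.
have {}kP i : exists k : int, alpha i = e (beta i) + c + k%:~R * (2 * pi).
  exact: kP.
have sinE i j : sin (alpha i - alpha j) = e (sin (beta i - beta j)).
  have [k ->] := kP i; have [l ->] := kP j.
  have -> : e (beta i) + c + k%:~R * (2 * pi) - (e (beta j) + c + l%:~R * (2 * pi))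
          = e (beta i - beta j) + (k - l)%:~R * (2 * pi).
    by rewrite intrB /e; case: s {kP e}; ring.
  by rewrite sinD2piz /e; case: s {kP e} => //; rewrite sinN.
pose x := sin (alpha v - alpha w) / sin (alpha v - alpha u).
pose y := sin (alpha w - alpha u) / sin (alpha v - alpha u).
(* The common sign cancels in the quotient, so the same coefficients serve in the (x3, x4)-plane. *)
have xE : x = sin (beta v - beta w) / sin (beta v - beta u).
  by rewrite /x !sinE /e; case: s {kP e sinE} => //; rewrite invrN mulrNN.
have yE : y = sin (beta w - beta u) / sin (beta v - beta u).
  by rewrite /y !sinE /e; case: s {kP e sinE} => //; rewrite invrN mulrNN.
have suv' : sin (beta v - beta u) != 0.
  move: suv; rewrite sinE /e; case: s {kP e sinE xE yE} => //.
  by rewrite oppr_eq0.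
suff -> : q w t = x *: q u t + y *: q v t.
  by rewrite rpredD // rpredZ // memv_span // !inE eqxx ?orbT.
have [_ [u0 u1 u2 u3]] := form u t Jt; have [_ [v0 v1 v2 v3]] := form v t Jt.
have [_ [w0 w1 w2 w3]] := form w t Jt.
have [ru rhou] := rE u w t Jt; have [rv rhov] := rE v w t Jt.
apply: row4P; rewrite !mxE ?u0 ?u1 ?u2 ?u3 ?v0 ?v1 ?v2 ?v3 ?w0 ?w1 ?w2 ?w3
  ?ru ?rv ?rhou ?rhov.
- by rewrite /x /y (cos_interp _ _ suv); ring.
- by rewrite /x /y (sin_interp _ _ suv); ring.
- by rewrite xE yE (cos_interp _ _ suv'); ring.
- by rewrite xE yE (sin_interp _ _ suv'); ring.
Qed.

(** * Exclusion of two bodies, and the polygon *)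

Lemma dot_sphere_sqr_lt1 (R : realType) (x y : 'rV[R]_4) :
  sphere3 x -> sphere3 y -> dot x y ^+ 2 != 1 -> dot x y ^+ 2 < 1.
Proof.
move=> x1 y1 n1; rewrite lt_neqAle n1 /=.
(* The squared norms of x - y and x + y bound the inner product by 1 and -1. *)
have := dot_ge0 (x - y); have := dot_ge0 (x - (- y)).
rewrite !dot_subr x1 y1.
have -> : dot (- y) (- y) = 1 by rewrite -y1 !dotE !mxE; ring.
have -> : dot x (- y) = - dot x y by rewrite !dotE !mxE; ring.
nra.
Qed.

(* The areal acceleration q_i1 q_i2'' - q_i2 q_i1'' is the same for both bodies,
   since q_1 is a rotated copy of q_0 in the (x1, x2)-plane; the equations of
   motion give it opposite signs. *)
Lemma two_bodies_not_rigid (R : realType) (J : set R) (m : 'I_2 -> R)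
    (q : 'I_2 -> R -> 'rV[R]_4) (r rho : 'I_2 -> R -> R) (theta phi : R -> R)
    (alpha beta : 'I_2 -> R) (t : R) :
  open J -> J t ->
  positive_elliptic_elliptic_rotopulsator J m q r rho theta phi alpha beta ->
  (forall i j t, J t -> r i t = r j t /\ rho i t = rho j t) ->
  r 0 t != 0 -> sin (alpha 1 - alpha 0) = 0.
Proof.
move=> oJ Jt [[m_gt0 sol] form] rE r0; apply/eqP/negPn/negP => sd0.
pose d := alpha 1 - alpha 0.
have rot s : J s ->
    q 1 s 0 0 = cos d * q 0 s 0 0 + (- sin d) * q 0 s 0 1 /\
    q 1 s 0 1 = sin d * q 0 s 0 0 + cos d * q 0 s 0 1.
  move=> Js; have [_ [-> -> _ _]] := form 0 s Js.
  have [_ [-> -> _ _]] := form 1 s Js; have [-> _] := rE 1 0 s Js.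
  have -> : theta s + alpha 1 = d + (theta s + alpha 0) by rewrite /d; ring.
  by rewrite (cosD d) (sinD d); split; ring.
have d1 i s : J s -> derivable (q i) s 1 by move=> Js; have [] := sol i s Js.
have d2 i s : J s -> derivable (derive1 (q i)) s 1.
  by move=> Js; have [] := sol i s Js.
have acc0 : derive1 (derive1 (q 1)) t 0 0 =
    cos d * derive1 (derive1 (q 0)) t 0 0
    + (- sin d) * derive1 (derive1 (q 0)) t 0 1.
  apply: (derive1_coord_lincomb oJ (d2 1) (d2 0)) Jt.
  by apply: (derive1_coord_lincomb oJ (d1 1) (d1 0)) => s /rot[].
have acc1 : derive1 (derive1 (q 1)) t 0 1 =
    sin d * derive1 (derive1 (q 0)) t 0 0
    + cos d * derive1 (derive1 (q 0)) t 0 1.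
  apply: (derive1_coord_lincomb oJ (d2 1) (d2 0)) Jt.
  by apply: (derive1_coord_lincomb oJ (d1 1) (d1 0)) => s /rot[].
have [_ ns0 _ _ eq0] := sol 0 t Jt; have [_ _ _ _ eq1] := sol 1 t Jt.
move: (derive1 (derive1 (q 0)) t) (derive1 (derive1 (q 1)) t) acc0 acc1 eq0 eq1.
move=> A0 A1 acc0 acc1 eq0 eq1.
have areal : q 1 t 0 0 * A1 0 1 - q 1 t 0 1 * A1 0 0
           = q 0 t 0 0 * A0 0 1 - q 0 t 0 1 * A0 0 0.
  have [-> ->] := rot t Jt; rewrite acc0 acc1.
  by rewrite -[RHS]mul1r -(cos2Dsin2 d); ring.
have dotC : dot (q 1 t) (q 0 t) = dot (q 0 t) (q 1 t).
  by rewrite !dotE; ring.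
pose c := dot (q 0 t) (q 1 t).
have c_lt1 : 0 < 1 - c ^+ 2.
  rewrite subr_gt0; have [x1 _ _ _ _] := sol 0 t Jt.
  have [y1 _ _ _ _] := sol 1 t Jt.
  by apply: dot_sphere_sqr_lt1 => //; exact: ns0.
have p_gt0 : 0 < (1 - c ^+ 2) `^ (3 / 2) by exact: powR_gt0.
(* Terms along q_i drop out of its areal acceleration. With S the [area] below, body 0 keeps m_1 S /
   p and body 1 keeps - m_0 S / p, so (m_0 + m_1) S / p = 0. *)
move: areal; rewrite eq0 eq1.
have sum0 F : \sum_(j < 2 | j != 0) F j = F 1 :> 'rV[R]_4.
  by rewrite (bigD1 1) //= big1 ?addr0 // => -[[|[|]]].
have sum1 F : \sum_(j < 2 | j != 1) F j = F 0 :> 'rV[R]_4.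
  by rewrite (bigD1 0) //= big1 ?addr0 // => -[[|[|]]].
rewrite sum0 sum1 dotC -/c !mxE.
have [_ [q00 q01 _ _]] := form 0 t Jt.
have area : q 0 t 0 0 * q 1 t 0 1 - q 0 t 0 1 * q 1 t 0 0
          = r 0 t ^+ 2 * sin d.
  have [-> ->] := rot t Jt; rewrite q00 q01.
  rewrite -[in RHS](mulr1 (_ ^+ 2)) -(cos2Dsin2 (theta t + alpha 0)); ring.
set p := _ `^ _ in p_gt0 *.
have : 0 < (m 0 + m 1) / p by rewrite divr_gt0 // addr_gt0.
move=> mp e; have : (m 0 + m 1) / p * (r 0 t ^+ 2 * sin d) = 0.
  rewrite -area; move: e => /eqP; rewrite -subr_eq0 => /eqP e.
  by rewrite -[RHS]oppr0 -e; ring.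
move=> /eqP; rewrite mulf_eq0 (gt_eqF mp) mulf_eq0 (negPf sd0) orbF.
by rewrite sqrf_eq0 (negPf r0).
Qed.

Lemma rigid_rotopulsator_polygon (R : realType) (J : set R) (n : nat)
    (m : 'I_n -> R) (q : 'I_n -> R -> 'rV[R]_4) (r rho : 'I_n -> R -> R)
    (theta phi : R -> R) (alpha beta : 'I_n -> R) :
  time_interval J -> (2 <= n)%N ->
  positive_elliptic_elliptic_rotopulsator J m q r rho theta phi alpha beta ->
  pulsating_with_fixed_distances J q r rho ->
  equal_phases J q r rho alpha beta /\
  forall t, J t ->
    polygon_vertices (fun i => q i t) /\
    exists C : set 'rV[R]_4, great_circle C /\ forall i, C (q i t).
Proof.
case: n m q r rho alpha beta => [|[|n]] // m q r rho alpha beta.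
move=> [[t0 Jt0] _ oJ] _ pos rigid.
have [sol form] := pos; have [rE rNcst _] := rigid.
have gram i j : cos (alpha i - alpha j) = cos (beta i - beta j).
  exact: cos_phases_eq form rigid.
have q1 i t : J t -> sphere3 (q i t) by move=> Jt; have [] := sol.2 i t Jt.
have dot_sqr i j t : j != i -> J t -> dot (q i t) (q j t) ^+ 2 != 1.
  by move=> ji Jt; have [_ ns _ _ _] := sol.2 i t Jt; exact: ns.
have dot_cos i j : dot (q i t0) (q j t0) = cos (alpha i - alpha j).
  have [[_ _ r1] _] := form i t0 Jt0; have [rj rhoj] := rE j i t0 Jt0.
  by rewrite (dot_elliptic _ _ form Jt0) -gram rj rhoj -mulrDl -!expr2 r1 mul1r.
(* Otherwise the inner product of bodies 0 and 1, a cosine, would be 1 or -1, which is singular. *)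
have sin01 : sin (alpha 1 - alpha 0) != 0.
  apply/eqP => s0; have /eqP := @dot_sqr 1 0 t0 isT Jt0; apply.
  by rewrite dot_cos cos2sin2 s0; ring.
split; first exact: equal_phases_of_gram form gram sin01.
have n3 : (3 <= n.+2)%N.
  case: n m q r rho alpha beta pos rigid sin01
    {sol form rE rNcst gram q1 dot_sqr dot_cos} => //.
  move=> m q r rho alpha beta pos rigid /eqP s01.
  have [rE rNcst _] := rigid; exfalso; apply: s01.
  (* A function vanishing on all of [J] would be constant there. *)
  have [t Jt rt0] : exists2 t, J t & r 0 t != 0.
    have [rN _] := rNcst 0; apply: contrapT => nr; apply: rN; exists 0 => t Jt.
    by apply/eqP/negPn/negP => rt0; apply: nr; exists t.
  exact: (two_bodies_not_rigid oJ Jt pos rE rt0).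
move=> t Jt.
have [cop circ] := great_circle_of_plane (fun i => q1 i t Jt)
  (dim_span_pair (q1 0 t Jt) (q1 1 t Jt) (dot_sqr 0 1 t isT Jt))
  (fun i => elliptic_in_span i form Jt rE gram sin01).
split=> //; split=> // i; apply: sphere_points_convex_position.
  exact: q1.
move=> j ji.
have := dot_sphere_sqr_lt1 (q1 i t Jt) (q1 j t Jt) (dot_sqr i j t ji Jt).
nra.
Qed.

(** * Existence: regular polygons with an odd number of vertices *)

Definition geodesic (R : realType) (t0 : R) (a b : 'rV[R]_4) (t : R) :
    'rV[R]_4 :=
  cos (t - t0) *: a + sin (t - t0) *: b.

(** For orthonormal [a] and [b] the curve is a great circle of unit speed. Differentiation turns the
    pair (a, b) into (b, - a), so that twice gives the opposite curve. *)
Lemma is_derive_geodesic (R : realType) (t0 : R) (a b : 'rV[R]_4) (t : R) :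
  is_derive t 1 (geodesic t0 a b) (geodesic t0 b (- a) t).
Proof.
have coordE i j : is_derive t 1 (fun s => geodesic t0 a b s i j)
    (geodesic t0 b (- a) t i j).
  have -> : (fun s => geodesic t0 a b s i j) =
      a i j \*: (cos \o (fun s : R => s - t0)) +
      b i j \*: (sin \o (fun s : R => s - t0)).
    by apply/funext => s; rewrite /geodesic !mxE !fctE /= /GRing.scale /=; ring.
  have dB : is_derive t 1 (fun s : R => s - t0) 1.
    by apply: is_derive_eq; rewrite subr0.
  have dc := @is_derive1_comp R cos _ t _ _ (is_derive_cos (t - t0)) dB.
  have ds := @is_derive1_comp R sin _ t _ _ (is_derive_sin (t - t0)) dB.
  apply: is_derive_eq; rewrite /geodesic !mxE /GRing.scale /=; ring.
have dv : derivable (geodesic t0 a b) t 1.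
  by apply/derivable_mxP => i j; have [] := coordE i j.
split=> //; rewrite derive_mx //; apply/matrixP => i j; rewrite mxE.
by have [_ ->] := coordE i j.
Qed.

Lemma derive1_geodesic (R : realType) (t0 : R) (a b : 'rV[R]_4) :
  derive1 (geodesic t0 a b) = geodesic t0 b (- a).
Proof.
apply/funext => t; rewrite derive1E.
by have [_ ->] := is_derive_geodesic t0 a b t.
Qed.

(** The index is a natural number, possibly beyond n, so that angles add without reduction modulo
    n. *)
Definition ngon_angle (R : realType) (n : nat) (i : nat) : R :=
  i%:R * (2 * pi) / n%:R.

Lemma ngon_angle_mod (R : realType) (n i j : nat) : (0 < n)%N ->
  i = j %[mod n] ->
  exists k : int, ngon_angle R n i = ngon_angle R n j + k%:~R * (2 * pi).
Proof.
move=> n0 ij; exists ((i %/ n)%:Z - (j %/ n)%:Z).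
have nR : n%:R != 0 :> R by rewrite pnatr_eq0 -lt0n.
rewrite /ngon_angle [in LHS](divn_eq i n) [in X in _ = X + _](divn_eq j n) ij.
by rewrite intrB !natrD !natrM; field.
Qed.

(** The angle lies strictly between 0 and 2 pi and equals pi only if 2 d = n, impossible for odd n.
    Thus distinct vertices are not antipodal. *)
Lemma sin_ngon_angle_neq0 (R : realType) (n d : nat) :
  odd n -> (0 < d < n)%N -> sin (ngon_angle R n d) != 0.
Proof.
move=> n_odd /andP[d0 dn].
have nR : 0 < n%:R :> R by rewrite ltr0n (leq_trans _ dn).
have p0 := pi_gt0 R.
have d0R : 0 < d%:R :> R by rewrite ltr0n.
have dnR : d%:R < n%:R :> R by rewrite ltr_nat.
have xn : ngon_angle R n d * n%:R = d%:R * (2 * pi).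
  by rewrite divfK // gt_eqF.
have [ltd|gtd|eqd] := ltngtP (2 * d) n.
- have ltdR : 2 * d%:R < n%:R :> R by rewrite -natrM ltr_nat.
  rewrite gt_eqF // sin_gt0_pi //; apply/andP; split.
    by rewrite -(ltr_pM2r nR) xn mul0r !mulr_gt0.
  by rewrite -(ltr_pM2r nR) xn; nra.
- have gtdR : n%:R < 2 * d%:R :> R by rewrite -natrM ltr_nat.
  rewrite -(subrK pi (ngon_angle R n d)) sinDpi oppr_eq0 gt_eqF //.
  rewrite sin_gt0_pi //.
  by apply/andP; split; rewrite -(ltr_pM2r nR) ?mul0r mulrBl xn; nra.
- by move: n_odd; rewrite -eqd oddM.
Qed.

Lemma sin_ngon_angle_sub_neq0 (R : realType) (n : nat) (i j : 'I_n) :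
  odd n -> j != i -> sin (ngon_angle R n j - ngon_angle R n i) != 0.
Proof.
move=> n_odd.
wlog ij : i j / (i < j)%N => [th ji|_].
  have [ltij|ltji|/val_inj eji] := ltngtP i j; first exact: th.
    by rewrite -opprB sinN oppr_eq0 th // eq_sym.
  by rewrite eji eqxx in ji.
have -> : ngon_angle R n j - ngon_angle R n i = ngon_angle R n (j - i).
  by rewrite /ngon_angle natrB ?(ltnW ij) // -mulrBl -mulrBl.
by apply: sin_ngon_angle_neq0 => //; have := ltn_ord j; lia.
Qed.

(* The reflection j |-> 2 i - j of Z/n fixes i and changes the sign of the
   relative angle. *)
Lemma ngon_sum_odd (R : realType) (n : nat) (i : 'I_n) (F : R -> R) :
  \sum_(j < n | j != i) F (cos (ngon_angle R n j - ngon_angle R n i)) *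
     sin (ngon_angle R n j - ngon_angle R n i) = 0.
Proof.
case: n i => [[]//|n] i.
(* The subtraction is that of ordinals, modulo n + 1, so angles are reflected only up to multiples
   of 2 pi. *)
set A := ngon_angle R n.+1; pose h (j : 'I_n.+1) : 'I_n.+1 := i + i - j.
have hK : involutive h by move=> j; rewrite /h subKr.
have [hc hs] : (forall j, cos (A (h j) - A i) = cos (A j - A i)) /\
               (forall j, sin (A (h j) - A i) = - sin (A j - A i)).
  suff angle j : exists k : int,
      A (h j) - A i = - (A j - A i) + k%:~R * (2 * pi).
    split=> j; have [k ->] := angle j;
      by rewrite (cosD2piz, sinD2piz) (cosN, sinN).
  have hmod : (h j + j)%N = (i + i)%N %[mod n.+1].
    by have /(congr1 val) /= := subrK j (i + i).
  have [k kP] := ngon_angle_mod R (ltn0Sn n) hmod; exists k.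
  have AD a b : ngon_angle R n.+1 (a + b)%N = A a + A b.
    by rewrite /A /ngon_angle natrD -mulrDl -mulrDl.
  rewrite !AD in kP.
  have -> : k%:~R * (2 * pi) = A (h j) + A j - (A i + A i).
    by rewrite kP addrC addKr.
  by ring.
set S := LHS; have : S = - S.
  rewrite /S [LHS](reindex_inj (inv_inj hK)) /= -sumrN; apply: eq_big => j.
    have hi : h i = i by rewrite /h addrK.
    by rewrite -{1}hi (inj_eq (inv_inj hK)).
  by move=> _; rewrite hc hs mulrN.
by move=> /eqP; rewrite -addr_eq0 -mulr2n mulrn_eq0 => /eqP.
Qed.

Lemma rigid_bodies_exist (R : realType) (J : set R) (n : nat) :
  time_interval J -> (3 <= n)%N -> odd n ->
  exists (m : 'I_n -> R) (q : 'I_n -> R -> 'rV[R]_4)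
    (r rho : 'I_n -> R -> R) (theta phi : R -> R) (alpha beta : 'I_n -> R),
    positive_elliptic_elliptic_rotopulsator J m q r rho theta phi alpha beta
    /\ pulsating_with_fixed_distances J q r rho.
Proof.
move=> [[t0 Jt0] _ oJ] n3 n_odd.
pose A (i : 'I_n) : R := ngon_angle R n i.
pose a i : 'rV[R]_4 := \row_k [:: cos (A i); sin (A i); 0; 0]`_k.
pose b i : 'rV[R]_4 := \row_k [:: 0; 0; cos (A i); sin (A i)]`_k.
pose q i := geodesic t0 (a i) (b i).
(* The radii must be nonnegative, so they are |cos| and |sin|; a negative sign becomes a jump of the
   angle by pi. *)
pose arg (x : R) : R := if x < 0 then pi else 0.
have polar x y : `|x| * cos (arg x + y) = x * cos y /\
                 `|x| * sin (arg x + y) = x * sin y.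
  rewrite /arg; case: ltP => x0; last by rewrite add0r ger0_norm.
  by rewrite addrC cosDpi sinDpi ltr0_norm // !mulrNN.
have q_coord i t : [/\ q i t 0 0 = cos (t - t0) * cos (A i),
    q i t 0 1 = cos (t - t0) * sin (A i),
    q i t 0 2 = sin (t - t0) * cos (A i) &
    q i t 0 3 = sin (t - t0) * sin (A i)].
  by rewrite /q /geodesic !mxE /=; split; ring.
have dq i t : derive1 (q i) t = geodesic t0 (b i) (- a i) t.
  by rewrite derive1_geodesic.
have ddq i t : derive1 (derive1 (q i)) t = - q i t.
  by rewrite !derive1_geodesic /q /geodesic !scalerN opprD.
have dotq i j t : dot (q i t) (q j t) = cos (A j - A i).
  rewrite dotE; have [-> -> -> ->] := q_coord i t.
  have [-> -> -> ->] := q_coord j t; rewrite (cosB (A j)).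
  by rewrite -[RHS]mulr1 -(cos2Dsin2 (t - t0)); ring.
have speed i t : dot (derive1 (q i) t) (derive1 (q i) t) = 1.
  rewrite dq -[RHS](cos0 R) -(subrr (A i)) -(dotq i i t) !dotE /q /geodesic.
  by rewrite !mxE /=; ring.
pose r (i : 'I_n) t := `|cos (t - t0)|.
pose rho (i : 'I_n) t := `|sin (t - t0)|.
pose theta t := arg (cos (t - t0)); pose phi t := arg (sin (t - t0)).
have form : elliptic_elliptic_form J q r rho theta phi A A.
  move=> i t _; split.
    by rewrite /r /rho !normr_ge0 !real_normK ?num_real // cos2Dsin2.
  have [c1 c2] := polar (cos (t - t0)) (A i).
  have [s1 s2] := polar (sin (t - t0)) (A i).
  by have [-> -> -> ->] := q_coord i t; split.
exists (fun=> 1), q, r, rho, theta, phi, A, A.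
split; first (split=> //; split=> //).
- move=> i t Jt; split.
  + by rewrite /sphere3 /= dotq subrr cos0.
  + move=> j ji; rewrite dotq cos2sin2 -subr_eq0 addrC addKr oppr_eq0 sqrf_eq0.
    exact: sin_ngon_angle_sub_neq0.
  + by have [] := is_derive_geodesic t0 (a i) (b i) t.
  + by rewrite derive1_geodesic; have [] := is_derive_geodesic t0 (b i) (- a i) t.
  (* At unit speed the velocity term is already q'' = - q, so the forces have to cancel. *)
  + rewrite ddq speed scale1r -[LHS]add0r; congr (_ + _); symmetry.
    (* q_i turned by a right angle in both coordinate planes: q_j is cos (A j - A i) q_i + sin (A j
       - A i) [perp], so all forces on body i point along [perp]. *)
    pose perp : 'rV[R]_4 :=
      \row_k [:: - q i t 0 1; q i t 0 0; - q i t 0 3; q i t 0 2]`_k.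
    have tangent j : q j t - dot (q i t) (q j t) *: q i t
                   = sin (A j - A i) *: perp.
      rewrite dotq (sinB (A j)) (cosB (A j)).
      have [i0 i1 i2 i3] := q_coord i t; have [j0 j1 j2 j3] := q_coord j t.
      apply: row4P; rewrite !mxE /= ?i0 ?i1 ?i2 ?i3 ?j0 ?j1 ?j2 ?j3;
        rewrite -[X in X - _]mulr1 -(cos2Dsin2 (A i)); ring.
    under eq_bigr => j _ do rewrite tangent dotq scalerA.
    rewrite -scaler_suml.
    by rewrite (ngon_sum_odd i (fun c => 1 / (1 - c ^+ 2) `^ (3 / 2))) scale0r.
- have [e e0 Je] : exists2 e : R, 0 < e & forall s, 0 < s < e -> J (t0 + s).
    have /nbhs_ballP[e /= e0 eJ] : nbhs t0 J by exact: open_nbhs_nbhs.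
    exists e => // s /andP[s0 se]; apply: eJ; rewrite /ball /=.
    by rewrite opprD addrA subrr add0r normrN gtr0_norm.
  (* e / 2 keeps t0 + s in [J], and s <= 1 < 2 gives sin s > 0. Between t0 and t0 + s, r leaves the
     value 1 and rho the value 0. *)
  pose s := Num.min (e / 2) 1.
  have s0 : 0 < s by rewrite lt_min divr_gt0 // ltr01.
  have se : s < e by rewrite gt_min ltr_pdivrMr // ltr_pMr // ltr1n.
  have s1 : s <= 1 by rewrite ge_min lexx orbT.
  have Jts : J (t0 + s) by apply: Je; rewrite s0.
  have sin_s : 0 < sin s by apply: sin2_gt0; rewrite s0 (le_lt_trans s1) // ltr1n.
  split=> // [i|i j].
  + split=> -[c cE]; have := cE _ Jts; rewrite -(cE _ Jt0) /r /rho.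
    * rewrite subrr cos0 normr1 addrC addKr => /cos1sin0 s_eq0.
      by move: sin_s; rewrite s_eq0 ltxx.
    * rewrite subrr sin0 normr0 addrC addKr => /normr0_eq0 s_eq0.
      by move: sin_s; rewrite s_eq0 ltxx.
  + exists (Num.sqrt (2 - 2 * cos (A j - A i))) => t _.
    rewrite /enorm dot_subr !dotq !subrr cos0; congr (Num.sqrt _); ring.
Qed.

Theorem theorem1p4 (R : realType) (J : set R) (hJ : time_interval J) :
  (forall n : nat, (3 <= n)%N -> odd n ->
     exists (m : 'I_n -> R) (q : 'I_n -> R -> 'rV[R]_4)
       (r rho : 'I_n -> R -> R) (theta phi : R -> R) (alpha beta : 'I_n -> R),
       positive_elliptic_elliptic_rotopulsator J m q r rho theta phi alpha beta
       /\ pulsating_with_fixed_distances J q r rho) /\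
  (forall (n : nat) (m : 'I_n -> R) (q : 'I_n -> R -> 'rV[R]_4)
     (r rho : 'I_n -> R -> R) (theta phi : R -> R) (alpha beta : 'I_n -> R),
     (2 <= n)%N ->
     positive_elliptic_elliptic_rotopulsator J m q r rho theta phi alpha beta ->
     pulsating_with_fixed_distances J q r rho ->
     equal_phases J q r rho alpha beta /\
     forall t, J t ->
       polygon_vertices (fun i => q i t) /\
       exists C : set 'rV[R]_4, great_circle C /\ forall i, C (q i t)).
Proof.
split=> [n|n m q r rho theta phi alpha beta]; first exact: rigid_bodies_exist.
exact: rigid_rotopulsator_polygon.
Qed.
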